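(* Let $(G,\tilde p,R)$ be a nominal formation in $\mathbb{R}^d$ with $G=(V,E)$, $V=\{1,\dots,n\}$, nominal positions $\tilde p=[\tilde p_1^\top,\dots,\tilde p_n^\top]^\top\in\mathbb{R}^{dn}$, $R\in \mathrm{SO}(d)$, leader set $V_l=\{1,\dots,m\}$ and follower set $V_f=\{m+1,\dots,n\}$, and let $L\in\mathbb{R}^{dn\times dn}$ be its matrix-valued Laplacian. Suppose that $L\succeq 0$, $\ker(L)=\varPi(\tilde p)$ and $L_{ff}\succ 0$. Let $v=n+1$ be a new agent, joining as a follower, with nominal position $\tilde p_v\in\mathbb{R}^d$, and let $i,j\in V$ be such that $\prod_{l=1}^d \tilde p^{\,l}_{ji,R}\neq 0$, where $\tilde p^{\,l}_{ji,R}$ is the $l$-th component of $R^\top(\tilde p_j-\tilde p_i)$. Let $D\in\mathbb{R}^{d\times d}$ be a diagonal matrix with $D\succ 0$. Put $$W_{jv}=\mathrm{diag}\big(R^\top(\tilde p_j-\tilde p_v)\big)R^\top,\quad W_{vi}=\mathrm{diag}\big(R^\top(\tilde p_v-\tilde p_i)\big)R^\top,\quad W_{vv}=W_{jv}+W_{vi},$$ and define $L^+\in\mathbb{R}^{d(n+1)\times d(n+1)}$ by $$L^+=\begin{bmatrix} L & 0\\ 0 & 0\end{bmatrix}+L^{ijv}_{\mathrm{pad}},$$ where $L^{ijv}_{\mathrm{pad}}$ is the $(n+1)\times(n+1)$ block matrix with $d\times d$ blocks whose blocks with row and column indices in $(i,j,v)$ (in this order) form $$\begin{bmatrix} W_{jv}^\top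 D W_{jv} & W_{jv}^\top D W_{vi} & -W_{jv}^\top D W_{vv}\\ W_{vi}^\top D W_{jv} & W_{vi}^\top D W_{vi} & -W_{vi}^\top D W_{vv}\\ -W_{vv}^\top D W_{jv} & -W_{vv}^\top D W_{vi} & W_{vv}^\top D W_{vv}\end{bmatrix},$$ and whose other blocks are all zero. Let $\tilde p^+=[\tilde p^\top,\tilde p_v^\top]^\top\in\mathbb{R}^{d(n+1)}$. Then $$L^+\succeq 0,\qquad \ker(L^+)=\varPi(\tilde p^+),\qquad L^+_{ff}\succ 0,$$ where $L^+_{ff}$ is the submatrix of $L^+$ formed by the blocks with row and column indices in $V_f\cup\{v\}$.
   Context: For $x\in\mathbb{R}^d$, $\mathrm{diag}(x)$ is the diagonal matrix with the entries of $x$ on its diagonal. $\mathrm{SO}(d)=\{R\in\mathbb{R}^{d\times d}: R^\top R=I_d,\ \det R=1\}$. $\succeq 0$ and $\succ 0$ mean symmetric positive semi-definite and symmetric positive definite. $\otimes$ is the Kronecker product and $1_N\in\mathbb{R}^N$ the all-ones vector. The graph $G=(V,E)$ is bidirectional: $E\subseteq\{(a,b):a,b\in V,\ a\ne b\}$ and $(a,b)\in E$ implies $(b,a)\in E$. A matrix-valued Laplacian of $(G,\tilde p,R)$ is a block matrix $L=[L_{ab}]\in\mathbb{R}^{dn\times dn}$ with blocks $L_{ab}\in\mathbb{R}^{d\times d}$, where for $a\neq b$ the block $L_{ab}$ is the matrix weight of the edge $(b,a)\in E$ (and is zero if $(b,a)\notin E$), and with zero block row sums: $\sum_{b=1}^n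 L_{ab}=0$ for every $a$. $L_{ff}$ is the submatrix of $L$ formed by the blocks with row and column indices in $V_f$. For $N\ge 1$ and $\tilde q\in\mathbb{R}^{dN}$ (a stack of $N$ vectors of $\mathbb{R}^d$), the desired shape space under non-uniform scaling, for the fixed $R$, is $$\varPi(\tilde q)=\left\{\big(I_N\otimes R\,\mathrm{diag}(s)R^\top\big)\tilde q+1_N\otimes\tau \;:\; s,\tau\in\mathbb{R}^d\right\}\subseteq\mathbb{R}^{dN}.$$ The extended graph is $G^+=(V\cup\{v\},\,E\cup\{(v,i),(i,v),(v,j),(j,v)\})$, and $L^+$ is the matrix called the Laplacian of the extended formation $(G^+,\tilde p^+,R)$. *)

(* Defs.v *)
From mathcomp Require Import all_boot all_order all_algebra.
From mathcomp Require Import mxtens classical_sets reals.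

Set Implicit Arguments.
Unset Strict Implicit.
Unset Printing Implicit Defensive.

Import Order.TTheory GRing.Theory Num.Theory.
Local Open Scope ring_scope.

(* [tensmx] carries this notation only inside its own section. *)
Notation "A *t B" := (tensmx A B)
  (at level 40, left associativity, format "A  *t  B") : ring_scope.

Section Blocks.
Variable K : realType.
Implicit Types m n d : nat.

(* A vector of R^(dn) has type ['cV_(n * d)]. Its coordinate [l] of agent [a]
   sits at [mxtens_index (a, l)], i.e. at position [a * d + l], which is the
   indexing of the Kronecker product [*t]. *)
Definition stack n d (q : 'I_n -> 'cV[K]_d) : 'cV[K]_(n * d) :=
  \col_k q (mxtens_unindex k).1 (mxtens_unindex k).2 0.

Definition blockmx m n d (B : 'I_m -> 'I_n -> 'M[K]_d) :
    'M[K]_(m * d, n * d) :=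
  \matrix_(k, l) B (mxtens_unindex k).1 (mxtens_unindex l).1
                   (mxtens_unindex k).2 (mxtens_unindex l).2.

Definition block m n d (A : 'M[K]_(m * d, n * d)) (a : 'I_m) (b : 'I_n) :
    'M[K]_d :=
  mxsub (fun k => mxtens_index (a, k)) (fun l => mxtens_index (b, l)) A.

(* The agents of [S] are taken in increasing order. *)
Definition block_restrict n d (S : {set 'I_n}) (A : 'M[K]_(n * d)) :
    'M[K]_(#|S| * d) :=
  blockmx (fun a b : 'I_#|S| => block A (enum_val a) (enum_val b)).

(* [[A, 0], [0, 0]]: [ord_max] is the added agent and [lift ord_max a] is the
   old agent [a]. *)
Definition extend_block n d (A : 'M[K]_(n * d)) : 'M[K]_(n.+1 * d) :=
  blockmx (fun a b : 'I_n.+1 =>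
    match unlift ord_max a, unlift ord_max b with
    | Some a', Some b' => block A a' b'
    | _, _ => 0
    end).

(* The blocks with indices in [s], in the order of [s], are the entries of the
   array [B]. An agent outside [s] has [index] equal to [size s], so that both
   [nth] fall back on their defaults and the block is zero. *)
Definition pad_block n d (s : seq 'I_n) (B : seq (seq 'M[K]_d)) :
    'M[K]_(n * d) :=
  blockmx (fun a b : 'I_n => nth 0 (nth [::] B (index a s)) (index b s)).

End Blocks.

Section Matrices.
Variable K : realType.
Implicit Types n d N : nat.

Definition diag d (x : 'cV[K]_d) : 'M[K]_d := diag_mx x^T.

Definition special_orthogonal d (R : 'M[K]_d) : Prop :=
  R^T *m R = 1%:M /\ \det R = 1.

Definition psdmx n (A : 'M[K]_n) : Prop :=
  A^T = A /\ forall x : 'cV[K]_n, 0 <= (x^T *m A *m x) 0 0.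

Definition pdmx n (A : 'M[K]_n) : Prop :=
  A^T = A /\ forall x : 'cV[K]_n, x != 0 -> 0 < (x^T *m A *m x) 0 0.

(* Column kernel; the library's [kermx] is the row kernel. *)
Definition ker m n (A : 'M[K]_(m, n)) : set 'cV[K]_n :=
  [set x | A *m x = 0]%classic.

Definition shape_space N d (R : 'M[K]_d) (q : 'cV[K]_(N * d)) :
    set 'cV[K]_(N * d) :=
  [set x | exists s tau : 'cV[K]_d,
     x = ((1%:M : 'M[K]_N) *t (R *m diag s *m R^T)) *m q
         + (const_mx 1 : 'cV[K]_N) *t tau]%classic.

(* [E a b] means that (a, b) is an edge. *)
Definition bidirectional n (E : rel 'I_n) : Prop :=
  irreflexive E /\ symmetric E.

Definition matrix_laplacian n d (E : rel 'I_n) (L : 'M[K]_(n * d)) : Prop :=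
  (forall a b : 'I_n, a != b -> ~~ E b a -> block L a b = 0) /\
  (forall a : 'I_n, \sum_(b < n) block L a b = 0).

(* Agents are numbered from 0, so the leaders are 0, ..., m - 1. *)
Definition followers n (m : nat) : {set 'I_n} := [set a : 'I_n | (m <= a)%N].

Definition followers_ext n (m : nat) : {set 'I_n.+1} :=
  ord_max |: [set lift ord_max a | a in followers n m].

Definition extend_pos n d (p : 'I_n -> 'cV[K]_d) (pv : 'cV[K]_d) :
    'I_n.+1 -> 'cV[K]_d :=
  fun a => if unlift ord_max a is Some a' then p a' else pv.

Definition laplacian_ext n d (R : 'M[K]_d) (p : 'I_n -> 'cV[K]_d)
    (L : 'M[K]_(n * d)) (pv : 'cV[K]_d) (i j : 'I_n) (D : 'M[K]_d) :
    'M[K]_(n.+1 * d) :=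
  let Wjv := diag (R^T *m (p j - pv)) *m R^T in
  let Wvi := diag (R^T *m (pv - p i)) *m R^T in
  let Wvv := Wjv + Wvi in
  extend_block L +
  pad_block [:: lift ord_max i; lift ord_max j; ord_max]
   [:: [:: Wjv^T *m D *m Wjv; Wjv^T *m D *m Wvi; - (Wjv^T *m D *m Wvv)];
       [:: Wvi^T *m D *m Wjv; Wvi^T *m D *m Wvi; - (Wvi^T *m D *m Wvv)];
       [:: - (Wvv^T *m D *m Wjv); - (Wvv^T *m D *m Wvi); Wvv^T *m D *m Wvv]].

End Matrices.

(* Main.v *)
(** The matrix [L^+] is a congruence sum [P^T L P + C^T D C], where [P] forgets
    the new agent and [C x] is the residual
    [W_jv x_i + W_vi x_j - W_vv x_v]. A sum of positive semi-definite terms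
    annihilates [x] exactly when each of them does, so [ker L^+] consists of the
    [x] with [P x] in [ker L] and [C x = 0]. On a shape [x_a = R diag(s) R^T p_a +
    tau], the residual vanishes iff [W_vv] annihilates the difference between [x_v]
    and [R diag(s) R^T p_v + tau]; since [W_vv = diag(R^T (p_j - p_i)) R^T] is
    invertible, this forces [x_v]. Positivity on the followers is the same
    argument with [x_i = x_j = 0]. *)
Require Import Defs.
From mathcomp Require Import all_boot all_order all_algebra.
From mathcomp Require Import mxtens classical_sets reals.
From mathcomp Require Import ring.

Set Implicit Arguments.
Unset Strict Implicit.
Unset Printing Implicit Defensive.

Import Order.TTheory GRing.Theory Num.Theory.
Local Open Scope ring_scope.

(** * Quadratic forms, semi-definiteness and congruence *)

Section QuadraticForms.
Variable K : realType.

Definition qform n (A : 'M[K]_n) (x : 'cV[K]_n) : K := (x^T *m A *m x) 0 0.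

Lemma qformD n (A B : 'M[K]_n) x : qform (A + B) x = qform A x + qform B x.
Proof. by rewrite /qform mulmxDr mulmxDl mxE. Qed.

Lemma qform_congr m n (A : 'M[K]_m) (P : 'M[K]_(m, n)) x :
  qform (P^T *m A *m P) x = qform A (P *m x).
Proof. by rewrite /qform trmx_mul !mulmxA. Qed.

Lemma qform0 n (A : 'M[K]_n) x : A *m x = 0 -> qform A x = 0.
Proof. by move=> Ax0; rewrite /qform -mulmxA Ax0 mulmx0 mxE. Qed.

Lemma sqnorm_ge0 n (x : 'cV[K]_n) : 0 <= (x^T *m x) 0 0.
Proof. by rewrite mxE sumr_ge0// => k _; rewrite mxE -expr2 sqr_ge0. Qed.

Lemma sqnorm_eq0 n (x : 'cV[K]_n) : (x^T *m x) 0 0 = 0 -> x = 0.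
Proof.
rewrite mxE => /eqP; rewrite psumr_eq0 => [/allP x0|k _]; last first.
  by rewrite mxE -expr2 sqr_ge0.
apply/matrixP => k l; rewrite (ord1 l) mxE; apply/eqP.
by have := x0 k (mem_index_enum _); rewrite mxE -expr2 sqrf_eq0.
Qed.

(** A zero of a non-negative form is a minimum, so the form has no first-order term there. In the
    direction [A *m x] that term is twice the squared norm of [A *m x]. *)
Lemma psd_qform_eq0 n (A : 'M[K]_n) (x : 'cV[K]_n) :
  psdmx A -> qform A x = 0 -> A *m x = 0.
Proof.
move=> [symA A_ge0] qx0; apply: sqnorm_eq0.
set w := A *m x; set c := (w^T *m w) 0 0; set q := qform A w.
have c_ge0 : 0 <= c := sqnorm_ge0 w.
have q_ge0 : 0 <= q := A_ge0 w.
have wx0 : w^T *m x = 0.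
  by apply/matrixP=> k l; rewrite !ord1 [RHS]mxE -[RHS]qx0 /w trmx_mul symA.
have expand t : qform A (x + t *: w) = t * c *+ 2 + t ^+ 2 * q.
  rewrite /qform [(_ + _)^T]linearD /= [(t *: w)^T]linearZ /= !mulmxDl !mulmxDr -!scalemxAl -!scalemxAr.
  rewrite -[w^T *m A *m x]mulmxA -/w (_ : x^T *m A = w^T); last first.
    by rewrite trmx_mul symA.
  rewrite wx0 /c /q /qform.
  by move: (w^T *m w) (w^T *m A *m w) => X Y; rewrite !mxE; ring.
(* The minimiser of the expansion in [t] is [- c / q]; shifting [q] by one
   avoids the case [q = 0]. *)
have := A_ge0 (x + (- c / (q + 1)) *: w); rewrite -/(qform _ _) expand.
have -> : - c / (q + 1) * c *+ 2 + (- c / (q + 1)) ^+ 2 * q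
  = - ((c / (q + 1)) ^+ 2 * (q + 2)) by field; rewrite gt_eqF// ltr_wpDl.
(* The value is both non-negative and minus a square times [q + 2 > 0], so the square is zero and
   [c = 0]. *)
rewrite oppr_ge0 => le0; apply/eqP.
have : (c / (q + 1)) ^+ 2 * (q + 2) == 0.
  by rewrite eq_le le0 mulr_ge0 ?sqr_ge0// addr_ge0.
rewrite mulf_eq0 [_ + 2 == 0]gt_eqF ?ltr_wpDl// orbF sqrf_eq0 mulf_eq0 invr_eq0.
by rewrite [_ + 1 == 0]gt_eqF ?ltr_wpDl// orbF.
Qed.

Lemma pd_psd n (A : 'M[K]_n) : pdmx A -> psdmx A.
Proof.
case=> symA A_gt0; split=> // x.
by have [->|/A_gt0/ltW//] := eqVneq x 0; rewrite mulmx0 mxE.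
Qed.

Lemma pd_qform_eq0 n (A : 'M[K]_n) x : pdmx A -> qform A x = 0 -> x = 0.
Proof.
case=> _ A_gt0 qx0; apply/eqP; apply: contraT => /A_gt0.
by rewrite -/(qform A x) qx0 ltxx.
Qed.

Lemma psd_congr m n (A : 'M[K]_m) (P : 'M[K]_(m, n)) :
  psdmx A -> psdmx (P^T *m A *m P).
Proof.
case=> symA A_ge0; split; first by rewrite !trmx_mul trmxK symA mulmxA.
by move=> x; rewrite -/(qform _ _) qform_congr; apply: A_ge0.
Qed.

Lemma psdD n (A B : 'M[K]_n) : psdmx A -> psdmx B -> psdmx (A + B).
Proof.
case=> symA A_ge0 [symB B_ge0]; split; first by rewrite linearD /= symA symB.
by move=> x; rewrite -/(qform _ _) qformD addr_ge0 ?A_ge0 ?B_ge0.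
Qed.

Lemma psd_injective_pd n (A : 'M[K]_n) :
  psdmx A -> (forall x, qform A x = 0 -> x = 0) -> pdmx A.
Proof.
move=> [symA A_ge0] inj; split=> // x; apply: contra_neqT.
rewrite -leNgt => qx_le0; apply: inj; apply/eqP.
by rewrite eq_le qx_le0 A_ge0.
Qed.

(** Both summands are non-negative, so both vanish. Semi-definiteness of [A] only places [P *m x] in
    its kernel, while definiteness of [D] kills [C *m x] itself. *)
Lemma qform_congr_sum_eq0 m k n (A : 'M[K]_m) (D : 'M[K]_k)
    (P : 'M[K]_(m, n)) (C : 'M[K]_(k, n)) x : psdmx A -> pdmx D ->
  qform (P^T *m A *m P + C^T *m D *m C) x = 0 ->
  A *m (P *m x) = 0 /\ C *m x = 0.
Proof.
move=> psdA pdD; rewrite qformD !qform_congr => /eqP.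
have [_ /(_ (P *m x)) A_ge0] := psdA.
have [_ /(_ (C *m x)) D_ge0] := pd_psd pdD.
rewrite paddr_eq0// => /andP[/eqP qA /eqP qD].
by split; [apply: psd_qform_eq0 | apply: pd_qform_eq0 qD].
Qed.

End QuadraticForms.

(** * Block operations expressed as products with selection matrices *)

Section BlockSelection.
Variable K : realType.

(** This is the Kronecker product of the row vector [e_a^T] with the identity of size [d]. Its
    transpose places a vector in block [a] and zero elsewhere. *)
Definition sel n d (a : 'I_n) : 'M[K]_(d, n * d) :=
  rowsub (fun l => mxtens_index (a, l)) 1%:M.

(** Reindexing of agents along [f]. For injective [f] the transpose is extension by zero outside the
    image of [f]. *)
Definition gather m n d (f : 'I_m -> 'I_n) : 'M[K]_(m * d, n * d) :=
  rowsub (fun k => mxtens_index (f (mxtens_unindex k).1, (mxtens_unindex k).2))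
    1%:M.

Lemma sel_mulE n d r (a : 'I_n) (x : 'M[K]_(n * d, r)) l k :
  (sel d a *m x) l k = x (mxtens_index (a, l)) k.
Proof. by rewrite /sel -rowsubE mxE. Qed.

Lemma sel_ext n d r (x y : 'M[K]_(n * d, r)) :
  (forall a, sel d a *m x = sel d a *m y) -> x = y.
Proof.
move=> xy; apply/matrixP => k l; case: (mxtens_indexP k) => a b.
by rewrite -!sel_mulE xy.
Qed.

Lemma sel_gather m n d (f : 'I_m -> 'I_n) a :
  sel d a *m gather d f = sel d (f a).
Proof.
by apply/matrixP => k l; rewrite sel_mulE !mxE mxtens_indexK.
Qed.

Lemma sel_tr n d (a b : 'I_n) : sel d a *m (sel d b)^T = (a == b)%:R%:M.
Proof.
apply/matrixP => k l; rewrite sel_mulE !mxE (can_eq (@mxtens_indexK _ _)).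
by rewrite xpair_eqE [b == a]eq_sym [l == k]eq_sym -mulrnA mulnb.
Qed.

Lemma gather_sel_tr m n d (f : 'I_m -> 'I_n) a : injective f ->
  gather d f *m (sel d (f a))^T = (sel d a)^T.
Proof.
by move=> injf; apply: sel_ext => b; rewrite mulmxA sel_gather !sel_tr inj_eq.
Qed.

Lemma gather_sel_tr0 m n d (f : 'I_m -> 'I_n) b : (forall a, f a != b) ->
  gather d f *m (sel d b)^T = 0.
Proof.
move=> fb; apply: sel_ext => a.
by rewrite mulmxA sel_gather sel_tr (negPf (fb a)) mulmx0 raddf0.
Qed.

Lemma sel_gather_tr m n d (f : 'I_m -> 'I_n) a : injective f ->
  sel d (f a) *m (gather d f)^T = sel d a.
Proof. by move=> injf; rewrite -[LHS]trmxK trmx_mul trmxK gather_sel_tr ?trmxK. Qed.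

Lemma sel_gather_tr0 m n d (f : 'I_m -> 'I_n) b : (forall a, f a != b) ->
  sel d b *m (gather d f)^T = 0.
Proof. by move=> fb; rewrite -[LHS]trmxK trmx_mul trmxK gather_sel_tr0 ?trmx0. Qed.

Lemma gather_trK m n d (f : 'I_m -> 'I_n) r (z : 'M[K]_(m * d, r)) :
  injective f -> gather d f *m ((gather d f)^T *m z) = z.
Proof.
by move=> injf; apply: sel_ext => a; rewrite !mulmxA sel_gather sel_gather_tr.
Qed.

Lemma blockE n d (A : 'M[K]_(n * d)) (a b : 'I_n) :
  block A a b = sel d a *m A *m (sel d b)^T.
Proof.
(* Transposing turns the right factor into a left product with [sel], which [sel_mulE] evaluates. *)
rewrite -[RHS]trmxK trmx_mul trmxK; apply/matrixP => k l.
by rewrite 2!mxE sel_mulE mxE sel_mulE.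
Qed.

Lemma block_blockmx n d (B : 'I_n -> 'I_n -> 'M[K]_d) a b :
  block (blockmx B) a b = B a b.
Proof. by apply/matrixP => k l; rewrite !mxE !mxtens_indexK. Qed.

Lemma block_ext n d (A B : 'M[K]_(n * d)) :
  (forall a b, block A a b = block B a b) -> A = B.
Proof.
move=> AB; apply/matrixP => k l.
case: (mxtens_indexP k) => a a'; case: (mxtens_indexP l) => b b'.
by have /matrixP/(_ a' b') := AB a b; rewrite !mxE.
Qed.

Lemma sel_stack n d (q : 'I_n -> 'cV[K]_d) a : sel d a *m stack q = q a.
Proof. by apply/matrixP => k l; rewrite sel_mulE !mxE mxtens_indexK ord1. Qed.

Lemma sel_tens1 n d (M : 'M[K]_d) (a : 'I_n) :
  sel d a *m ((1%:M : 'M[K]_n) *t M) = M *m sel d a.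
Proof.
apply/matrixP => k l; case: (mxtens_indexP l) => b c.
rewrite sel_mulE tensmxE !mxE (bigD1 c)//= big1 ?addr0.
  by rewrite !mxE (can_eq (@mxtens_indexK _ _)) xpair_eqE eqxx andbT mulrC.
move=> e /negPf ec; rewrite !mxE (can_eq (@mxtens_indexK _ _)) xpair_eqE ec.
by rewrite andbF mulr0.
Qed.

(** Agentwise form of the shape space, free of Kronecker products. *)
Lemma shape_spaceP n d (R : 'M[K]_d) (q : 'I_n -> 'cV[K]_d) x :
  shape_space R (stack q) x <-> exists s tau : 'cV[K]_d,
    forall a, sel d a *m x = R *m diag s *m R^T *m q a + tau.
Proof.
have sel_shape s (tau : 'cV[K]_d) a :
    sel d a *m (((1%:M : 'M[K]_n) *t (R *m diag s *m R^T)) *m stack q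
         + (const_mx 1 : 'cV[K]_n) *t tau)
    = R *m diag s *m R^T *m q a + tau.
  rewrite mulmxDr mulmxA sel_tens1 -[in LHS]mulmxA sel_stack; congr (_ + _).
  apply/matrixP => k l; rewrite sel_mulE !mxE mxtens_indexK mul1r.
  by congr (tau _ _); rewrite !ord1.
split=> [[s [tau ->]]|[s [tau xE]]]; exists s, tau => //.
by apply: sel_ext => a; rewrite xE sel_shape.
Qed.

Lemma block_restrictE n d (S : {set 'I_n}) (A : 'M[K]_(n * d)) :
  block_restrict S A = gather d (@enum_val _ (mem S)) *m A
                       *m (gather d (@enum_val _ (mem S)))^T.
Proof.
apply: block_ext => a b; rewrite block_blockmx !blockE !mulmxA sel_gather.
by rewrite -!mulmxA -trmx_mul sel_gather.
Qed.

Lemma extend_blockE n d (A : 'M[K]_(n * d)) :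
  extend_block A
  = (gather d (lift ord_max))^T *m A *m gather d (lift ord_max).
Proof.
have out a : lift ord_max a != ord_max :> 'I_n.+1 by rewrite eq_sym neq_lift.
apply: block_ext => a b; rewrite block_blockmx blockE !mulmxA.
case: (unliftP ord_max a) => [a' ->|->]; last first.
  by rewrite sel_gather_tr0 // !mul0mx.
rewrite sel_gather_tr; last exact: lift_inj.
case: (unliftP ord_max b) => [b' ->|->]; rewrite -mulmxA.
  by rewrite gather_sel_tr ?blockE; last exact: lift_inj.
by rewrite gather_sel_tr0 // mulmx0.
Qed.

(** The array is the outer product of the weights [W1, W2, - W3] around [D]. Distinctness is guarded
    by ['I_d] because for [d = 0] the empty product is nonzero even when [i = j]; the matrices then
    have no entries. *)
Lemma pad_blockE n d (x y z : 'I_n) (W1 W2 W3 D : 'M[K]_d) :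
  ('I_d -> uniq [:: x; y; z]) ->
  let C := W1 *m sel d x + W2 *m sel d y - W3 *m sel d z in
  pad_block [:: x; y; z]
   [:: [:: W1^T *m D *m W1; W1^T *m D *m W2; - (W1^T *m D *m W3)];
       [:: W2^T *m D *m W1; W2^T *m D *m W2; - (W2^T *m D *m W3)];
       [:: - (W3^T *m D *m W1); - (W3^T *m D *m W2); W3^T *m D *m W3]]
  = C^T *m D *m C.
Proof.
move=> uniq_xyz C; apply: block_ext => a b; rewrite block_blockmx blockE.
apply/matrixP => k l; have := uniq_xyz k.
rewrite !cons_uniq !inE negb_or andbT => /andP[/andP[/negPf xy /negPf xz] /negPf yz].
pose W := [:: W1; W2; - W3].
(* An agent outside the triple has index 3, where [nth] defaults to zero, in agreement with [C]. *)
have selC c : C *m (sel d c)^T = W`_(index c [:: x; y; z]).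
  rewrite mulmxBl mulmxDl -!mulmxA !sel_tr !mul_mx_scalar /=.
  have [<-|_] := eqVneq x c.
    by rewrite [y == x]eq_sym [z == x]eq_sym xy xz scale1r !scale0r subr0 addr0.
  have [<-|_] := eqVneq y c.
    by rewrite [z == y]eq_sym yz scale1r !scale0r subr0 add0r.
  have [_|_] := eqVneq z c; first by rewrite scale1r !scale0r !add0r.
  by rewrite !scale0r subr0 addr0.
rewrite !mulmxA -[sel d a *m C^T]trmxK trmx_mul trmxK -[_ *m C *m _]mulmxA !selC.
congr ((_ : 'M[K]_d) k l); move: (index a _) (index b _) => u w.
case: u => [|[|[|u]]]; case: w => [|[|[|w]]];
by rewrite /= ?nth_nil ?raddfN /= ?mulNmx ?mulmxN ?opprK
           ?trmx0 ?mul0mx ?mulmx0 ?oppr0.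
Qed.

End BlockSelection.

Arguments sel {K n} d a.
Arguments gather {K m n} d f.

(** * The residual of three agents in rotated coordinates *)

Section Residual.
Variable K : realType.

Lemma diag_mulE d (u y : 'cV[K]_d) k : (diag u *m y) k 0 = u k 0 * y k 0.
Proof. by rewrite mul_diag_mx !mxE. Qed.

Lemma diagD d (u w : 'cV[K]_d) : diag (u + w) = diag u + diag w.
Proof. by rewrite /diag linearD /= raddfD. Qed.

(** After rotation by [R^T] this is, in each coordinate, [(b - c)(s a + t) + (c - a)(s b + t) = (b -
    a)(s c + t)]: affine maps preserve affine combinations. *)
Lemma residual_shape d (R : 'M[K]_d) (pi pj pv s tau : 'cV[K]_d) :
  R^T *m R = 1%:M ->
  diag (R^T *m (pj - pv)) *m R^T *m (R *m diag s *m R^T *m pi + tau)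
  + diag (R^T *m (pv - pi)) *m R^T *m (R *m diag s *m R^T *m pj + tau)
  = diag (R^T *m (pj - pi)) *m R^T *m (R *m diag s *m R^T *m pv + tau).
Proof.
move=> RtR.
have RtE q : R^T *m (R *m diag s *m R^T *m q + tau)
    = diag s *m (R^T *m q) + R^T *m tau.
  by rewrite mulmxDr !mulmxA RtR mul1mx.
rewrite -![diag _ *m R^T *m _]mulmxA !RtE !mulmxBr.
move: (R^T *m pi) (R^T *m pj) (R^T *m pv) (R^T *m tau) => a b c t.
apply/matrixP => k l; rewrite (ord1 l) {l} mxE !diag_mulE.
rewrite ![(diag s *m _ + t) k 0]mxE !diag_mulE !mxE; ring.
Qed.

Lemma diag_rot_inj d (R : 'M[K]_d) (u y : 'cV[K]_d) :
  R^T *m R = 1%:M -> \prod_(l < d) u l 0 != 0 ->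
  diag u *m R^T *m y = 0 -> y = 0.
Proof.
move=> /mulmx1C RRt /prodf_neq0 u_neq0 uRy.
have Ry : R^T *m y = 0.
  apply/matrixP => k l; rewrite (ord1 l) [RHS]mxE; apply/eqP.
  have /matrixP/(_ k 0) := uRy; rewrite -mulmxA diag_mulE [RHS]mxE => /eqP.
  by rewrite mulf_eq0 (negPf (u_neq0 k _)).
by rewrite -[y]mul1mx -RRt -mulmxA Ry mulmx0.
Qed.

End Residual.

(** * The extended Laplacian as a sum of two congruences *)

Section Extension.
Variable K : realType.

(** The last weight is [W_vv] simplified: [pv] cancels, so its invertibility depends only on [p i]
    and [p j]. *)
Definition residual n d (R : 'M[K]_d) (p : 'I_n -> 'cV[K]_d)
    (pv : 'cV[K]_d) (i j : 'I_n) : 'M[K]_(d, n.+1 * d) :=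
  diag (R^T *m (p j - pv)) *m R^T *m sel d (lift ord_max i)
  + diag (R^T *m (pv - p i)) *m R^T *m sel d (lift ord_max j)
  - diag (R^T *m (p j - p i)) *m R^T *m sel d ord_max.

Lemma residual_mulE n d (R : 'M[K]_d) (p : 'I_n -> 'cV[K]_d) pv i j
    (x : 'cV[K]_(n.+1 * d)) :
  residual R p pv i j *m x
  = diag (R^T *m (p j - pv)) *m R^T *m (sel d (lift ord_max i) *m x)
  + diag (R^T *m (pv - p i)) *m R^T *m (sel d (lift ord_max j) *m x)
  - diag (R^T *m (p j - p i)) *m R^T *m (sel d ord_max *m x).
Proof. by rewrite mulmxBl mulmxDl -!mulmxA. Qed.

Lemma laplacian_extE n d (R : 'M[K]_d) (p : 'I_n -> 'cV[K]_d)
    (L : 'M[K]_(n * d)) pv i j (D : 'M[K]_d) :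
  \prod_(l < d) (R^T *m (p j - p i)) l 0 != 0 ->
  laplacian_ext R p L pv i j D
  = (gather d (lift ord_max))^T *m L *m gather d (lift ord_max)
    + (residual R p pv i j)^T *m D *m residual R p pv i j.
Proof.
move=> /prodf_neq0 pij; rewrite /laplacian_ext extend_blockE; congr (_ + _).
have -> : diag (R^T *m (p j - pv)) *m R^T + diag (R^T *m (pv - p i)) *m R^T
    = diag (R^T *m (p j - p i)) *m R^T.
  by rewrite -mulmxDl -diagD -mulmxDr addrA subrK.
apply: pad_blockE => l; rewrite /= !inE negb_or ![_ == ord_max]eq_sym.
rewrite !(negPf (neq_lift _ _)) !andbT (inj_eq lift_inj).
(* If [i = j], coordinate [l] of the rotated difference would be zero. *)
by apply: contra_neq (pij l isT) => ->; rewrite subrr mulmx0 mxE.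
Qed.

End Extension.

Theorem theorem1 (K : realType) (d n m : nat) (hm : (m <= n)%N)
    (E : rel 'I_n) (hE : bidirectional E)
    (p : 'I_n -> 'cV[K]_d)
    (R : 'M[K]_d) (hR : special_orthogonal R)
    (L : 'M[K]_(n * d)) (hL : matrix_laplacian E L)
    (hLpsd : psdmx L)
    (hLker : ker L = shape_space R (stack p))
    (hLff : pdmx (block_restrict (followers n m) L))
    (pv : 'cV[K]_d) (i j : 'I_n)
    (hij : \prod_(l < d) (R^T *m (p j - p i)) l 0 != 0)
    (D : 'M[K]_d) (hDdiag : is_diag_mx D) (hDpd : pdmx D) :
  let Lplus := laplacian_ext R p L pv i j D in
  psdmx Lplus /\
  ker Lplus = shape_space R (stack (extend_pos p pv)) /\
  pdmx (block_restrict (followers_ext n m) Lplus).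
Proof.
move=> Lplus; have [RtR _] := hR.
set P := gather d (lift ord_max) : 'M[K]_(n * d, n.+1 * d).
set C := residual R p pv i j.
have LplusE : Lplus = P^T *m L *m P + C^T *m D *m C by apply: laplacian_extE.
have psdLplus : psdmx Lplus.
  by rewrite LplusE; apply: psdD; apply: psd_congr => //; apply: pd_psd.
have qLplus_eq0 x : qform Lplus x = 0 -> L *m (P *m x) = 0 /\ C *m x = 0.
  by rewrite LplusE; apply: qform_congr_sum_eq0.
have selP x a : sel d a *m (P *m x) = sel d (lift ord_max a) *m x.
  by rewrite mulmxA sel_gather.
have kerL x : L *m x = 0 <-> shape_space R (stack p) x by rewrite -hLker.
have Pp a : extend_pos p pv (lift ord_max a) = p a.
  by rewrite /extend_pos liftK.
have Pv : extend_pos p pv ord_max = pv by rewrite /extend_pos unlift_none.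
split=> //; split.
  apply/seteqP; split=> x; rewrite /ker /=.
    move=> /qform0/qLplus_eq0[/kerL/shape_spaceP[s [tau xE]] Cx].
    apply/shape_spaceP; exists s, tau => a.
    case: (unliftP ord_max a) => [a' ->|->]; first by rewrite Pp -selP xE.
    (* The difference is negated so that, after [residual_shape], its image is exactly the residual
       [C *m x]. *)
    rewrite Pv; apply/eqP; rewrite -subr_eq0 -oppr_eq0; apply/eqP.
    apply: (diag_rot_inj RtR hij); rewrite opprB mulmxBr.
    by rewrite -(residual_shape _ _ _ _ _ RtR) -!xE !selP -residual_mulE.
  move=> /shape_spaceP[s [tau xE]]; rewrite LplusE mulmxDl -!mulmxA.
  have -> : L *m (P *m x) = 0.
    apply/kerL/shape_spaceP; exists s, tau => a; by rewrite selP xE Pp.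
  have -> : C *m x = 0.
    by rewrite residual_mulE !xE !Pp Pv residual_shape // subrr.
  by rewrite !mulmx0 addr0.
move: hLff; rewrite !block_restrictE.
set F := gather d _; set F' := gather d _ => hLff.
have injF : injective (@enum_val _ (mem (followers n m))) := @enum_val_inj _ _.
have injF' : injective (@enum_val _ (mem (followers_ext n m))) :=
  @enum_val_inj _ _.
apply: psd_injective_pd => [|z].
  (* Writing [F'] as a double transpose exhibits the submatrix as a congruence by [F'^T]. *)
  by rewrite -{1}[F']trmxK; apply: psd_congr.
rewrite -{1}[F']trmxK qform_congr => /qLplus_eq0.
(* [x] extends [z] by zero on the leaders. *)
set x := F'^T *m z => -[LPx Cx].
have Px_out a : a \notin followers n m -> sel d a *m (P *m x) = 0.
  move=> aF; rewrite selP /x mulmxA sel_gather_tr0 ?mul0mx // => b.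
  apply: contraNneq aF => fb; have := enum_valP b; rewrite fb !inE.
  rewrite eq_sym (negPf (neq_lift _ _)) /= mem_imset ?inE //.
  exact: lift_inj.
(* [P *m x] is supported on the old followers, so restricting to them and extending back by zero
   loses nothing. The form of [L] at [P *m x] is thus that of [L_ff] at its restriction. *)
have PxE : F^T *m (F *m (P *m x)) = P *m x.
  apply: sel_ext => a; have [aF|aF] := boolP (a \in followers n m).
    by rewrite -(enum_rankK_in aF aF) !mulmxA sel_gather_tr // sel_gather.
  rewrite (Px_out _ aF) mulmxA sel_gather_tr0 ?mul0mx // => b.
  by apply: contraNneq aF => <-; apply: enum_valP.
have FPx : F *m (P *m x) = 0.
  apply: (pd_qform_eq0 hLff); rewrite -{1}[F]trmxK qform_congr PxE.
  exact: qform0.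
have Px : P *m x = 0 by rewrite -PxE FPx mulmx0.
(* All old agents are now at zero, so the residual reduces to the invertible weight applied to the
   new agent. *)
have xv : sel d ord_max *m x = 0.
  apply: (diag_rot_inj RtR hij); apply/eqP; rewrite -oppr_eq0; apply/eqP.
  by move: Cx; rewrite residual_mulE -!selP Px !mulmx0 addr0 sub0r.
have x0 : x = 0.
  apply: sel_ext => a; rewrite mulmx0.
  by case: (unliftP ord_max a) => [a' ->|->] //; rewrite -selP Px mulmx0.
by rewrite -[z](gather_trK _ injF') -/x x0 mulmx0.
Qed.
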